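(* Let $A\in\mathbb{R}^{n\times n}$ be symmetric positive definite, let $P\in\mathbb{R}^{n\times s}$ have linearly independent columns, let $r\in\mathbb{R}^n$, and let $G=P^TAP=D+L+L^T$ with $D$ diagonal and $L$ strictly lower triangular. There is a function $C(s)=O(s)$ of $s$ alone such that the following holds for any Forward Gauss--Seidel sweep. Given the current iterate $\alpha^{(\nu)}\in\mathbb{R}^s$, let $\tilde\alpha^{(\nu+1)}$ be the solution of the lower triangular system $(D+L)\alpha=P^Tr-L^T\alpha^{(\nu)}$ computed by forward substitution in floating-point arithmetic with machine precision $\epsilon_{\text{mach}}$. Then $$(D+L)\tilde\alpha^{(\nu+1)}=P^Tr-L^T\alpha^{(\nu)}+\delta r$$ for some $\delta r\in\mathbb{R}^s$ with $$\|\delta r\|\le \epsilon_{\text{mach}}\,C(s)\left(\|P^Tr\|+\|D+L\|\,\|\tilde\alpha^{(\nu+1)}\|\right).$$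
   Context: Floating-point arithmetic follows the standard rounding model: $\mathrm{fl}(x\,\mathrm{op}\,y)=(x\,\mathrm{op}\,y)(1+\delta)$ with $|\delta|\le\epsilon_{\text{mach}}$ for each basic operation $\mathrm{op}\in\{+,-,\times,/\}$. Forward substitution for $(D+L)\alpha=b$ computes, for $j=1,\dots,s$ in order, $\alpha_j=D_{jj}^{-1}\bigl(b_j-\sum_{i<j}L_{ji}\alpha_i\bigr)$. $\|\cdot\|$ is the Euclidean norm on vectors and the induced norm on matrices. The (exact) Forward Gauss--Seidel iteration for $G\alpha=P^Tr$ is $(D+L)\alpha^{(\nu+1)}=P^Tr-L^T\alpha^{(\nu)}$.
   Formalization: The formal theorem additionally assumes s·ε_mach < 1, without which the claim is false; the right-hand side P^T r − L^T α is taken exact and each inner sum is accumulated in order of increasing index i. *)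

(* Defs.v *)
From mathcomp Require Import all_boot all_order all_algebra.
From mathcomp Require Import all_classical all_reals all_analysis.
Set Implicit Arguments.
Unset Strict Implicit.
Unset Printing Implicit Defensive.
Import Order.TTheory GRing.Theory Num.Theory.
Import numFieldNormedType.Exports.
Local Open Scope classical_set_scope.
Local Open Scope ring_scope.

(* The library norm `|v| on matrices is the max norm, so the Euclidean norm and
   the matrix norm it induces are defined separately. *)
Definition enorm (R : realType) (m : nat) (v : 'cV[R]_m) : R :=
  Num.sqrt (\sum_(i < m) v i ord0 ^+ 2).

Definition opnorm (R : realType) (m n : nat) (M : 'M[R]_(m, n)) : R :=
  sup [set enorm (M *m x) | x in [set x : 'cV[R]_n | enorm x <= 1]].

Definition sym_posdef (R : realType) (n : nat) (A : 'M[R]_n) : Prop :=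
  A^T = A /\
  forall x : 'cV[R]_n, x != 0 -> 0 < (x^T *m A *m x) ord0 ord0.

Definition strictly_lower (R : realType) (s : nat) (L : 'M[R]_s) : Prop :=
  forall i j : 'I_s, (i <= j)%N -> L i j = 0.

(* [rounds_to eps z zh]: zh is an admissible value of fl(z), where z is the
   exact result of one basic operation.  This is a relation, so that the
   relative errors of different operations are independent of each other. *)
Definition rounds_to (R : realType) (eps z zh : R) : Prop :=
  exists2 delta : R, `|delta| <= eps & zh = z * (1 + delta).

(* [fl_fwd_subst eps D L b a]: a is a result of forward substitution for
   (D + L) a = b in floating-point arithmetic.  For row j, p i is the computed
   product L_ji a_i, t k the computed sum of the first k products (accumulated
   in order of increasing i), d the computed difference b_j - t_j, and q the
   computed inverse of D_jj.  As zero errors are admissible, both starting the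
   accumulation at 0 and multiplying by q cover the variants that start it at
   the first product or perform a single division d / D_jj. *)
Definition fl_fwd_subst (R : realType) (eps : R) (s : nat) (D L : 'M[R]_s)
    (b a : 'cV[R]_s) : Prop :=
  forall j : 'I_s, exists (p : 'I_s -> R) (t : nat -> R) (d q : R),
    [/\ t 0%N = 0,
        forall i : 'I_s, (i < j)%N ->
          rounds_to eps (L j i * a i ord0) (p i) /\
          rounds_to eps (t i + p i) (t i.+1),
        rounds_to eps (b j ord0 - t j) d,
        rounds_to eps (1 / D j j) q
      & rounds_to eps (q * d) (a j ord0)].

(* Main.v *)
(* Put T = D + L.  In row j, forward substitution commits, up to a factor
   (1 + eps)^s <= e, an error at most eps times the sum of the absolute values
   of the products L_ji a_i and of the partial sums t_k = sum_(i < k) L_ji a_i.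
   For fixed k and varying j, the t_k are entries of T y where y is a truncated
   to its first k coordinates; hence their Euclidean norm is at most |T| |a|,
   and the at most s values of k contribute s |T| |a|.  Bounding |t_k| by
   sum_i |L_ji a_i| instead would cost a further factor of order sqrt s. *)
Require Import Defs.
From mathcomp Require Import all_boot all_order all_algebra.
From mathcomp Require Import all_classical all_reals all_analysis.
From mathcomp Require Import ring lra.
Set Implicit Arguments.
Unset Strict Implicit.
Import Order.TTheory GRing.Theory Num.Theory.
Import numFieldNormedType.Exports.
Local Open Scope classical_set_scope.
Local Open Scope ring_scope.

(** * Euclidean norm and induced matrix norm *)

Section EuclideanNorm.
Context {R : realType}.
Implicit Types m n : nat.

Lemma sum_sqr_ge0 m (v : 'cV[R]_m) : 0 <= \sum_(i < m) v i ord0 ^+ 2.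
Proof. by apply: sumr_ge0 => i _; exact: sqr_ge0. Qed.

Lemma enorm_ge0 m (v : 'cV[R]_m) : 0 <= enorm v.
Proof. exact: sqrtr_ge0. Qed.

Lemma enorm_sqr m (v : 'cV[R]_m) : enorm v ^+ 2 = \sum_(i < m) v i ord0 ^+ 2.
Proof. by rewrite sqr_sqrtr// sum_sqr_ge0. Qed.

Lemma enorm0 m : enorm (0 : 'cV[R]_m) = 0.
Proof. by rewrite /enorm big1 ?sqrtr0// => i _; rewrite mxE expr0n. Qed.

Lemma enormZ m (c : R) (v : 'cV[R]_m) : enorm (c *: v) = `|c| * enorm v.
Proof.
rewrite /enorm (eq_bigr (fun i => c ^+ 2 * v i ord0 ^+ 2)) => [|i _].
  by rewrite -mulr_sumr sqrtrM ?sqr_ge0// sqrtr_sqr.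
by rewrite mxE exprMn.
Qed.

Lemma enorm_le m (u v : 'cV[R]_m) :
  (forall i, `|u i ord0| <= `|v i ord0|) -> enorm u <= enorm v.
Proof.
move=> uv; rewrite ler_sqrt ?sum_sqr_ge0//; apply: ler_sum => i _.
by rewrite -[u _ _ ^+ 2]real_normK ?num_real// -[v _ _ ^+ 2]real_normK ?num_real//
  lerXn2r ?nnegrE.
Qed.

Lemma entry_le_enorm m (v : 'cV[R]_m) i : `|v i ord0| <= enorm v.
Proof.
rewrite -sqrtr_sqr ler_sqrt ?sum_sqr_ge0// (bigD1 i)//= lerDl.
by apply: sumr_ge0 => j _; exact: sqr_ge0.
Qed.

Lemma enorm_eq0 m (v : 'cV[R]_m) : enorm v = 0 -> v = 0.
Proof.
move=> v0; apply/matrixP => i j; rewrite ord1 mxE.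
by apply/eqP; rewrite -normr_le0 -v0 entry_le_enorm.
Qed.

(** Expanding the sum of the squares of [|v| u_i - |u| v_i] gives [2 |u| |v| (|u| |v| - S)] with [S]
    the inner product. Dividing by [|u| |v|] requires both vectors to be nonzero. *)
Lemma cauchy_schwarz m (u v : 'cV[R]_m) :
  \sum_(i < m) u i ord0 * v i ord0 <= enorm u * enorm v.
Proof.
have [/enorm_eq0 ->|u0] := eqVneq (enorm u) 0.
  by rewrite enorm0 mul0r big1// => i _; rewrite mxE mul0r.
have [/enorm_eq0 ->|v0] := eqVneq (enorm v) 0.
  by rewrite enorm0 mulr0 big1// => i _; rewrite mxE mulr0.
have uv_gt0 : 0 < enorm u * enorm v.
  by rewrite mulr_gt0// lt_neqAle enorm_ge0 andbT eq_sym.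
have : 0 <= \sum_(i < m) (enorm v * u i ord0 - enorm u * v i ord0) ^+ 2.
  by apply: sumr_ge0 => i _; exact: sqr_ge0.
rewrite (eq_bigr (fun i => enorm v ^+ 2 * u i ord0 ^+ 2
  + enorm u ^+ 2 * v i ord0 ^+ 2
  - 2 * (enorm u * enorm v) * (u i ord0 * v i ord0))); last by move=> i _; ring.
rewrite big_split/= sumrN big_split/= -!mulr_sumr -!enorm_sqr.
set S := \sum_(i < m) _ => h.
rewrite -(ler_pM2l uv_gt0); move: h; lra.
Qed.

Lemma enormD m (u v : 'cV[R]_m) : enorm (u + v) <= enorm u + enorm v.
Proof.
rewrite -ler_sqr ?nnegrE ?addr_ge0 ?enorm_ge0// enorm_sqr sqrrD !enorm_sqr.
rewrite (eq_bigr (fun i => u i ord0 ^+ 2 + v i ord0 ^+ 2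
  + 2 * (u i ord0 * v i ord0))); last by move=> i _; rewrite mxE; ring.
rewrite !big_split/= -mulr_sumr.
have := cauchy_schwarz u v; lra.
Qed.

Lemma enorm_sum_le m (I : finType) (v : I -> 'cV[R]_m) (c : R) :
  (forall i, enorm (v i) <= c) -> enorm (\sum_i v i) <= #|I|%:R * c.
Proof.
move=> vc; apply: (@le_trans _ _ (\sum_i enorm (v i))).
  elim/big_ind2: _ => [|x a y b xa yb|//]; first by rewrite enorm0.
  by apply: le_trans (enormD _ _) _; exact: lerD.
apply: le_trans (ler_sum _ (fun i _ => vc i)) _.
by rewrite sumr_const mulr_natl.
Qed.

(** Makes the [sup] in [opnorm] a genuine least upper bound. The entries of [x] are at most 1 in
    absolute value, so absolute row sums bound the entries of [M *m x]. *)
Lemma opnorm_has_ubound m n (M : 'M[R]_(m, n)) :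
  has_ubound [set enorm (M *m x) | x in [set x : 'cV[R]_n | enorm x <= 1]].
Proof.
exists (enorm (\col_i \sum_j `|M i j|)) => _ [x /= x1 <-].
apply: enorm_le => i; rewrite !mxE.
apply: le_trans (ler_norm_sum _ _ _) _; rewrite [leRHS]ger0_norm ?sumr_ge0//.
apply: ler_sum => j _; rewrite normrM ler_piMr//.
exact: le_trans (entry_le_enorm _ _) x1.
Qed.

Lemma opnorm_ge0 m n (M : 'M[R]_(m, n)) : 0 <= opnorm M.
Proof.
apply: (ub_le_sup (opnorm_has_ubound M)); exists 0; first by rewrite /= enorm0.
by rewrite mulmx0 enorm0.
Qed.

Lemma enorm_mulmx_le m n (M : 'M[R]_(m, n)) (x : 'cV[R]_n) :
  enorm (M *m x) <= opnorm M * enorm x.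
Proof.
have [/enorm_eq0 ->|x0] := eqVneq (enorm x) 0.
  by rewrite mulmx0 !enorm0 mulr0.
have x_gt0 : 0 < enorm x by rewrite lt_neqAle enorm_ge0 andbT eq_sym.
rewrite -ler_pdivrMr// mulrC -[(enorm x)^-1]ger0_norm ?invr_ge0 ?enorm_ge0//.
rewrite -enormZ scalemxAr; apply: (ub_le_sup (opnorm_has_ubound M)).
exists ((enorm x)^-1 *: x) => //=.
by rewrite enormZ ger0_norm ?invr_ge0 ?enorm_ge0// mulVf.
Qed.

Lemma entry_le_opnorm m n (M : 'M[R]_(m, n)) i j : `|M i j| <= opnorm M.
Proof.
have e1 : enorm (delta_mx j ord0 : 'cV[R]_n) = 1.
  rewrite /enorm (bigD1 j)//= big1 => [|k kj]; last first.
    by rewrite mxE (negbTE kj) expr0n.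
  by rewrite mxE !eqxx expr1n addr0 sqrtr1.
rewrite -[opnorm M]mulr1 -e1; apply: le_trans (enorm_mulmx_le _ _).
by rewrite -colE; apply: le_trans (entry_le_enorm _ i); rewrite mxE.
Qed.

End EuclideanNorm.

(** * Rounding errors of sums and divisions *)

Section Rounding.
Context {R : realType}.
Implicit Types eps : R.

Lemma big_ord_ltS s m (ms : (m < s)%N) (f : 'I_s -> R) :
  \sum_(i < s | (i < m.+1)%N) f i
  = \sum_(i < s | (i < m)%N) f i + f (Ordinal ms).
Proof.
rewrite (bigD1 (Ordinal ms))//= addrC; congr (_ + _); apply: eq_bigl => i.
by rewrite ltnS [RHS]ltn_neqAle andbC.
Qed.

Lemma exprS1_le_expR eps s m : 0 <= eps -> s%:R * eps < 1 -> (m <= s)%N ->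
  (1 + eps) ^+ m <= expR 1.
Proof.
move=> eps0 seps ms; apply: (@le_trans _ _ (expR eps ^+ m)).
  by rewrite lerXn2r ?nnegrE ?expR_ge0 ?addr_ge0 ?expR_ge1Dx.
rewrite -expRM_natl ler_expR; apply: le_trans (ltW seps).
by rewrite ler_wpM2r// ler_nat.
Qed.

(** The exact partial sums stay inside the absolute values, since it is these that become entries of
    [T *m trunc k] below. *)
Lemma recursive_sum_error {eps s} {x p : 'I_s -> R} {t : nat -> R} m :
  0 <= eps -> (m <= s)%N -> t 0%N = 0 ->
  (forall i : 'I_s, (i < m)%N ->
     rounds_to eps (x i) (p i) /\ rounds_to eps (t i + p i) (t i.+1)) ->
  `|t m - \sum_(i < s | (i < m)%N) x i| <=
    eps * (1 + eps) ^+ m *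
    (\sum_(i < s | (i < m)%N) `|x i|
     + \sum_(k < s | (k < m)%N) `|\sum_(i < s | (i < k.+1)%N) x i|).
Proof.
move=> eps0 + t0; elim: m => [|m IHm] ms tp.
  by rewrite t0 !big_pred0// subrr normr0 !mulr_ge0 ?exprn_ge0 ?addr_ge0.
pose o := Ordinal ms.
have {IHm} := IHm (ltnW ms) (fun i im => tp i (ltnW im)).
have [[d1 d1e p1] [d2 d2e t1]] := tp o (ltnSn m).
rewrite !big_ord_ltS t1 p1 -/o /=.
set S := \sum_(i < s | (i < m)%N) x i; set U := \sum_(i < s | _) `|x i|.
set V := \sum_(k < s | _) `|_|; set y := x o => IH.
(* The old error is amplified by [1 + d2]; the rounded product adds a multiple of [y], and the
   rounded addition a multiple of the new exact partial sum [S + y]. *)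
have -> : (t m + y * (1 + d1)) * (1 + d2) - (S + y) =
  (1 + d2) * (t m - S) + (1 + d2) * d1 * y + d2 * (S + y) by ring.
have d2' : `|1 + d2| <= 1 + eps by rewrite (le_trans (ler_normD _ _))// normr1 lerD2l.
have X1 : 1 <= (1 + eps) ^+ m by rewrite exprn_ege1// lerDl.
have X2 : 1 <= (1 + eps) ^+ m.+1 by rewrite exprn_ege1// lerDl.
apply: (@le_trans _ _ ((1 + eps) * (eps * (1 + eps) ^+ m * (U + V))
   + (1 + eps) * eps * `|y| + eps * `|S + y|)).
  apply: le_trans (ler_normD _ _) _; apply: lerD; last first.
    by rewrite normrM ler_wpM2r.
  apply: le_trans (ler_normD _ _) _; rewrite !normrM; apply: lerD.
    exact: ler_pM.
  by rewrite ler_wpM2r// ler_pM.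
(* Powers of [1 + eps], being at least 1, pad the last two terms to the common factor
   [(1 + eps) ^+ m.+1]. *)
rewrite [leRHS](_ : _ = (1 + eps) * (eps * (1 + eps) ^+ m * (U + V))
   + (1 + eps) * eps * `|y| * (1 + eps) ^+ m + eps * `|S + y| * (1 + eps) ^+ m.+1).
  apply: lerD; last by rewrite ler_peMr// mulr_ge0.
  by apply: lerD => //; rewrite ler_peMr// !mulr_ge0// addr_ge0.
by rewrite exprS; ring.
Qed.

(** The factor is [7 = 4 + 2 + 1], as each [1 + d] is at most 2 in absolute value. *)
Lemma rounded_product_error eps d1 d2 d3 : 0 <= eps -> eps <= 1 ->
  `|d1| <= eps -> `|d2| <= eps -> `|d3| <= eps ->
  `|(1 + d1) * (1 + d2) * (1 + d3) - 1| <= 7 * eps.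
Proof.
move=> e0 e1 h1 h2 h3.
have -> : (1 + d1) * (1 + d2) * (1 + d3) - 1 =
  d1 * ((1 + d2) * (1 + d3)) + d2 * (1 + d3) + d3 by ring.
have n2 : `|1 + d2| <= 2 by have := ler_normD 1 d2; rewrite normr1; lra.
have n3 : `|1 + d3| <= 2 by have := ler_normD 1 d3; rewrite normr1; lra.
apply: le_trans (ler_normD _ _) _.
have a1 : `|d1 * ((1 + d2) * (1 + d3))| <= eps * (2 * 2).
  by rewrite !normrM !ler_pM// mulr_ge0.
have a2 : `|d2 * (1 + d3)| <= eps * 2 by rewrite normrM ler_pM.
by have := ler_normD (d1 * ((1 + d2) * (1 + d3))) (d2 * (1 + d3)); lra.
Qed.

Lemma rounded_division {eps D c d q a} : 0 <= eps -> eps <= 1 -> D != 0 ->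
  rounds_to eps c d -> rounds_to eps (1 / D) q -> rounds_to eps (q * d) a ->
  `|D * a - c| <= 7 * eps * `|c|.
Proof.
move=> e0 e1 D0 [d1 h1 ->] [d2 h2 ->] [d3 h3 ->].
have -> : D * (1 / D * (1 + d2) * (c * (1 + d1)) * (1 + d3)) - c =
  ((1 + d2) * (1 + d1) * (1 + d3) - 1) * c by field.
by rewrite normrM ler_wpM2r// rounded_product_error.
Qed.

(** Measures the error against the computed [D * a] instead of [c]. With [eps <= 2^-1] each factor
    [1 + d] is at least 1/2, so their product is at least 1/8, whence [56 = 7 * 8]. *)
Lemma rounded_division_half {eps D c d q a} : 0 <= eps -> eps <= 2^-1 -> D != 0 ->
  rounds_to eps c d -> rounds_to eps (1 / D) q -> rounds_to eps (q * d) a ->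
  `|D * a - c| <= 56 * eps * `|D * a|.
Proof.
move=> e0 e1 D0 [d1 h1 ->] [d2 h2 ->] [d3 h3 ->].
have -> : D * (1 / D * (1 + d2) * (c * (1 + d1)) * (1 + d3)) =
  ((1 + d2) * (1 + d1) * (1 + d3)) * c by field.
have le1D d' : `|d'| <= eps -> 2^-1 <= 1 + d' by rewrite ler_norml => /andP[]; lra.
have lb : 8^-1 <= (1 + d2) * (1 + d1) * (1 + d3).
  rewrite (_ : 8^-1 = 2^-1 * 2^-1 * 2^-1 :> R); last by field.
  by rewrite !ler_pM ?mulr_ge0 ?invr_ge0 ?le1D.
have e1' : eps <= 1 by lra.
have := rounded_product_error e0 e1' h2 h1 h3.
move: ((1 + d2) * (1 + d1) * (1 + d3)) lb => w lb hw.
rewrite -[X in _ - X]mul1r -mulrBl !normrM mulrA ler_wpM2r//.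
apply: (le_trans hw); rewrite ger0_norm; last by lra.
by have := ler_wpM2l e0 lb; lra.
Qed.

End Rounding.

(** The entry is the quadratic form of [A] at column [j] of [P], which is nonzero by independence of
    the columns. *)
Lemma gram_diag_gt0 (R : realType) (n s : nat) (A : 'M[R]_n) (P : 'M[R]_(n, s))
    (j : 'I_s) :
  sym_posdef A -> row_free P^T -> 0 < (P^T *m A *m P) j j.
Proof.
move=> [_ Apos] Pfree; have /Apos : col j P != 0.
  rewrite -trmx_eq0 tr_col rowE; apply/eqP.
  rewrite -[RHS](mul0mx 1 P^T) => /(row_free_inj Pfree)/matrixP/(_ 0 j)/eqP.
  by rewrite !mxE !eqxx oner_eq0.
rewrite tr_col -row_mul colE mulmxA -colE -row_mul.
by rewrite [col j _ _ _]mxE [row j _ _ _]mxE.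
Qed.

(** * Residual of forward substitution *)

Section ForwardSubstitution.
Context {R : realType} {s : nat} {D L : 'M[R]_s} {eps : R} {b a : 'cV[R]_s}.
Hypotheses (Ddiag : is_diag_mx D) (Llow : strictly_lower L).
Hypotheses (Dneq0 : forall j, D j j != 0) (eps_ge0 : 0 <= eps).
Hypothesis (fwd : fl_fwd_subst eps D L b a).

Local Notation T := (D + L).

Lemma lower_entry_lt (i j : 'I_s) : (i < j)%N -> T j i = L j i.
Proof.
move=> ij; rewrite mxE (is_diag_mxP Ddiag) ?add0r//.
by rewrite gtn_eqF.
Qed.

Lemma lower_mul_row (j : 'I_s) :
  (T *m a) j ord0 = D j j * a j ord0 + \sum_(i < s | (i < j)%N) L j i * a i ord0.
Proof.
rewrite mxE (bigID (fun i : 'I_s => (i < j)%N))/= addrC; congr (_ + _); last first.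
  by apply: eq_bigr => i ij; rewrite lower_entry_lt.
rewrite (bigD1 j) ?ltnn//= big1 ?addr0 => [|i /andP[ij inj]].
  by rewrite mxE Llow// addr0.
rewrite mxE (is_diag_mxP Ddiag) 1?eq_sym// add0r Llow ?mul0r//.
by rewrite leqNgt.
Qed.

Let trunc (k : 'I_s) : 'cV[R]_s := \col_i (if (i < k.+1)%N then a i ord0 else 0).
(** Plays for the products [L j k * a k ord0] the role that [trunc k] plays for the partial sums:
    for fixed [k] they are entries of [T *m single k]. *)
Let single (k : 'I_s) : 'cV[R]_s := \col_i (if i == k then a i ord0 else 0).

Lemma trunc_mul (j k : 'I_s) : (k < j)%N ->
  (T *m trunc k) j ord0 = \sum_(i < s | (i < k.+1)%N) L j i * a i ord0.
Proof.
move=> kj; rewrite mxE [RHS]big_mkcond; apply: eq_bigr => i _.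
rewrite [trunc _ _ _]mxE; case: ifP => ik; rewrite ?mulr0//.
by rewrite lower_entry_lt// (leq_ltn_trans _ kj).
Qed.

Lemma single_mul (j k : 'I_s) : (k < j)%N ->
  (T *m single k) j ord0 = L j k * a k ord0.
Proof.
move=> kj; rewrite mxE (bigD1 k)//= [single _ _ _]mxE eqxx lower_entry_lt// big1 ?addr0//.
by move=> i ik; rewrite [single _ _ _]mxE (negbTE ik) mulr0.
Qed.

Lemma fwd_subst_row_error (j : 'I_s) : (1 < s)%N -> s%:R * eps < 1 ->
  `|(T *m a - b) j ord0| <= eps * (56 * `|D j j * a j ord0|
     + expR 1 * (\sum_k `|(T *m single k) j ord0|
                 + \sum_k `|(T *m trunc k) j ord0|)).
Proof.
move=> s1 seps; have [p [t [d [q [t0 tp hd hq ha]]]]] := fwd j.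
have ehalf : eps <= 2^-1.
  have : 2 * eps <= s%:R * eps by rewrite ler_wpM2r// ler_nat.
  by move: seps; lra.
have := rounded_division_half eps_ge0 ehalf (Dneq0 j) hd hq ha.
have := recursive_sum_error (m := j) eps_ge0 (ltnW (ltn_ord j)) t0 tp.
rewrite [(T *m a - b) _ _]mxE lower_mul_row [(- b) _ _]mxE.
set S := \sum_(i < s | _) (_ * _); set U := \sum_(i < s | _) `|_|.
set V := \sum_(i < s | _) `|_| => hsum hdiv.
(* Letting [k] range over all indices instead of [k < j] only adds nonnegative terms and makes the
   summation range independent of the row. *)
have UV : U + V <= \sum_k `|(T *m single k) j ord0|
    + \sum_k `|(T *m trunc k) j ord0|.
  apply: lerD; rewrite /U /V big_mkcond; apply: ler_sum => k _.
    by case: ifP => // kj; rewrite single_mul.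
  by case: ifP => // kj; rewrite trunc_mul.
(* The division error is separated from the summation error. *)
have -> : D j j * a j ord0 + S - b j ord0 =
  (D j j * a j ord0 - (b j ord0 - t j)) - (t j - S) by ring.
apply: le_trans (ler_normB _ _) _; rewrite mulrDr; apply: lerD.
  by rewrite mulrA [eps * _]mulrC.
apply: (le_trans hsum); rewrite -mulrA ler_wpM2l// ler_pM// ?exprn_ge0 ?addr_ge0 ?sumr_ge0//.
by rewrite (@exprS1_le_expR _ _ s)// ltnW.
Qed.

Lemma fwd_subst_residual : (1 < s)%N -> s%:R * eps < 1 ->
  enorm (T *m a - b) <=
    eps * ((56 + 2 * expR 1) * s%:R) * (opnorm T * enorm a).
Proof.
move=> s1 seps; pose N := opnorm T * enorm a.
have N0 : 0 <= N by rewrite mulr_ge0 ?opnorm_ge0 ?enorm_ge0.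
(* Entrywise absolute values leave the Euclidean norm unchanged, so the triangle inequality applies
   to the sums in the row bounds. *)
pose absv (v : 'cV[R]_s) : 'cV[R]_s := \col_j `|v j ord0|.
have absvT (v : 'cV[R]_s) :
    (forall j, `|v j ord0| <= `|a j ord0|) -> enorm (absv (T *m v)) <= N.
  move=> va; apply: le_trans (ler_wpM2l (opnorm_ge0 _) (enorm_le va)).
  apply: le_trans (enorm_mulmx_le _ _); apply: enorm_le => j.
  by rewrite [absv _ _ _]mxE normr_id.
pose dv : 'cV[R]_s := \col_j `|D j j * a j ord0|.
have dvN : enorm dv <= N.
  rewrite /N -[opnorm T]ger0_norm ?opnorm_ge0// -enormZ; apply: enorm_le => j.
  rewrite !mxE normr_id !normrM ler_wpM2r// [leRHS]ger0_norm ?opnorm_ge0//.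
  by apply: le_trans (entry_le_opnorm _ j j); rewrite mxE Llow// addr0.
have sumN (v : 'I_s -> 'cV[R]_s) :
    (forall k j, `|v k j ord0| <= `|a j ord0|) ->
    enorm (\sum_k absv (T *m v k)) <= s%:R * N.
  move=> va; rewrite -[s in s%:R]card_ord; apply: enorm_sum_le => k.
  exact/absvT/va.
have sN : enorm (\sum_k absv (T *m single k)) <= s%:R * N.
  apply: sumN => k j; rewrite mxE; by case: ifP => _ //; rewrite normr0.
have tN : enorm (\sum_k absv (T *m trunc k)) <= s%:R * N.
  apply: sumN => k j; rewrite mxE; by case: ifP => _ //; rewrite normr0.
(* The row bounds are exactly the entries of this vector. *)
apply: (@le_trans _ _ (enorm (eps *: (56 *: dv + expR 1 *:
    (\sum_k absv (T *m single k) + \sum_k absv (T *m trunc k)))))).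
  apply: enorm_le => j; apply: le_trans (fwd_subst_row_error j s1 seps) _.
  apply: le_trans (ler_norm _); rewrite le_eqVlt; apply/orP; left; apply/eqP.
  rewrite !mxE !summxE; congr (_ * (_ + _ * (_ + _))).
    by apply: eq_bigr => k _; rewrite [RHS]mxE.
  by apply: eq_bigr => k _; rewrite [RHS]mxE.
rewrite enormZ ger0_norm// -mulrA ler_wpM2l//.
have e0 := expR_ge0 (1 : R).
apply: le_trans (enormD _ _) _; rewrite !enormZ !ger0_norm//.
have hD := enormD (\sum_k absv (T *m single k)) (\sum_k absv (T *m trunc k)).
have hE := ler_wpM2l e0 (le_trans hD (lerD sN tN)).
(* The diagonal contributes [56 * N] without a factor [s]; it is absorbed into the linear
   constant. *)
have s1' : N <= s%:R * N by rewrite ler_peMl// ler1n ltnW.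
rewrite -/N; move: hE; lra.
Qed.

End ForwardSubstitution.

Unset Implicit Arguments.
Set Strict Implicit.

Theorem theorem1 (R : realType) :
  exists2 C : nat -> R, C =O_\oo (fun m : nat => m%:R : R) &
  forall (n s : nat) (A : 'M[R]_n) (P : 'M[R]_(n, s)) (r : 'cV[R]_n)
    (D L : 'M[R]_s) (eps : R) (alpha alpha' : 'cV[R]_s),
    sym_posdef A ->
    row_free P^T ->
    is_diag_mx D ->
    strictly_lower L ->
    P^T *m A *m P = D + L + L^T ->
    0 <= eps ->
    s%:R * eps < 1 ->
    fl_fwd_subst eps D L (P^T *m r - L^T *m alpha) alpha' ->
    exists dr : 'cV[R]_s,
      (D + L) *m alpha' = P^T *m r - L^T *m alpha + dr /\
      enorm dr <= eps * C s *
        (enorm (P^T *m r) + opnorm (D + L) * enorm alpha').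
Proof.
exists (fun s => (56 + 2 * expR 1) * s%:R).
  apply/eqOP; exists (56 + 2 * expR 1); split; first exact: num_real.
  move=> k kC; near=> m.
  rewrite normrM [`|56 + _|]ger0_norm ?addr_ge0 ?mulr_ge0 ?expR_ge0//.
  by rewrite ler_wpM2r// ltW.
move=> n s A P r D L eps a a' Apos Pfree Ddiag Llow GE eps0 seps fwd.
exists ((D + L) *m a' - (P^T *m r - L^T *m a)); split.
  by rewrite [RHS]addrC subrK.
(* [L] has zero diagonal, so [D] carries the diagonal of the Gram matrix. *)
have Dneq0 j : D j j != 0.
  have := gram_diag_gt0 j Apos Pfree.
  by rewrite GE !mxE !Llow// !addr0 => /lt0r_neq0.
have e1_ge0 := expR_ge0 (1 : R).
have N0 : 0 <= opnorm (D + L) * enorm a'.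
  by rewrite mulr_ge0 ?opnorm_ge0 ?enorm_ge0.
have b0 := enorm_ge0 (P^T *m r).
(* For [s >= 2] the hypothesis [s%:R * eps < 1] gives [eps <= 2^-1], and the bound holds even
   without the term in [P^T *m r]. *)
have [s1|] := ltnP 1 s.
  apply: le_trans (fwd_subst_residual Ddiag Llow Dneq0 eps0 fwd s1 seps) _.
  by rewrite ler_wpM2l ?lerDr// !mulr_ge0// addr_ge0// mulr_ge0.
(* For [s <= 1] the precision may be close to 1, so the error cannot be bounded
   by the computed [a'], but [L = 0] and the right-hand side is [P^T r]. *)
move=> s1; have s_eq (i j : 'I_s) : i = j.
  apply/val_inj => /=; have := leq_trans (ltn_ord i) s1.
  by have := leq_trans (ltn_ord j) s1; rewrite !ltnS !leqn0 => /eqP-> /eqP->.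
have L0 : L = 0 by apply/matrixP => i j; rewrite (s_eq i j) mxE Llow.
have res : enorm ((D + L) *m a' - (P^T *m r - L^T *m a))
    <= 7 * eps * enorm (P^T *m r).
  rewrite -[7 * eps]ger0_norm ?mulr_ge0// -enormZ; apply: enorm_le => j.
  have [p [t [d [q [t0 tp hd hq ha]]]]] := fwd j.
  (* The only row has an empty sum, so just the difference, the inverse and the final product are
     rounded. *)
  have j0 : j = 0%N :> nat.
    by apply/eqP; rewrite -leqn0 -ltnS (leq_trans (ltn_ord j) s1).
  have eps1 : eps <= 1.
    apply: le_trans (ltW seps); rewrite ler_peMl// ler1n.
    exact: leq_trans (ltn_ord j).
  have := rounded_division eps0 eps1 (Dneq0 j) hd hq ha.
  rewrite j0 t0 subr0 L0 trmx0 mul0mx subr0 addr0.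
  rewrite [in X in _ -> X <= _]mxE [in X in _ -> _ <= X]mxE.
  rewrite normrM [`|7 * eps|]ger0_norm ?mulr_ge0//.
  congr (`|_ + _| <= _); last by rewrite [RHS]mxE.
  rewrite mxE (bigD1 j)//= big1 ?addr0// => i /eqP[]; exact: s_eq.
(* The constant vanishes at [s = 0], where all vectors are empty; for [s = 1] it exceeds 7. *)
have [s0|s_gt0] := posnP s.
  have -> : (D + L) *m a' - (P^T *m r - L^T *m a) = 0.
    by apply/matrixP => i; exfalso; have := ltn_ord i;
      move: (val i) => k; rewrite s0.
  by rewrite enorm0 mulr_ge0 ?addr_ge0 ?mulr_ge0 ?opnorm_ge0 ?enorm_ge0.
apply: (le_trans res); rewrite [7 * eps]mulrC.
apply: ler_pM; rewrite ?mulr_ge0 ?lerDl//; apply: ler_wpM2l => //.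
have s1R : 1 <= s%:R :> R by rewrite ler1n.
by apply: (@le_trans _ _ (56 + 2 * expR 1)); [lra | rewrite ler_peMr//; lra].
Unshelve. all: by end_near.
Qed.
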